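(* Let $\mathcal S$ be a finite, locally irreducible and subcritical abelian network, with global monoid $\mathscr F(\mathcal S)$ acting on $\mathscr Q$, and let $e$ be the minimal idempotent of $\mathscr F(\mathcal S)$. Let $\eta:\mathscr F(\mathcal S)\to\mathrm{End}(\overline{\mathrm{Rec}}(\mathcal S))$ be the monoid homomorphism induced by the action of $\mathscr F(\mathcal S)$ on $\overline{\mathrm{Rec}}(\mathcal S)$, whose image is the shift monoid $\mathscr M(\mathcal S)$ with identity $\epsilon$. Then: (i) the map $F:e\mathscr F(\mathcal S)\to\mathrm{Tor}(\mathcal S)$, $em\mapsto\overline{(\eta(em),\epsilon)}$, is an isomorphism of groups; (ii) $e\mathscr Q=\overline{\mathrm{Rec}}(\mathcal S)=\overline{\mathrm{Rec}}(\mathcal S)^\times$; (iii) the isomorphism $F$ preserves the actions of $e\mathscr F(\mathcal S)$ and $\mathrm{Tor}(\mathcal S)$ on $e\mathscr Q=\overline{\mathrm{Rec}}(\mathcal S)^\times$.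
   Context: Abelian networks. $\mathbb N=\{0,1,2,\dots\}$. Let $G=(V,E)$ be a finite directed graph (self-loops and multiple edges allowed). An abelian network $\mathcal N$ on $G$ assigns to each $v\in V$ a nonempty input alphabet $A_v$ and a nonempty state space $Q_v$ (the $A_v$ pairwise disjoint), maps $T_a:Q_v\to Q_v$ for $a\in A_v$, and, for each edge $e$ from $v$ to $u$, a message-passing function $T_e:Q_v\times A_v\to A_u^*$ (free monoid of words), such that for all $v$, $a,b\in A_v$, $q\in Q_v$: $T_aT_b=T_bT_a$, and for every edge $e$ out of $v$ the words $T_e(q,a)T_e(T_a(q),b)$ and $T_e(q,b)T_e(T_b(q),a)$ agree up to permuting letters. Put $A=\bigsqcup_v A_v$, $Q=\prod_v Q_v$; $\mathcal N$ is finite if $A$ and $Q$ are finite. For a word $w\in A^*$, $|w|\in\mathbb N^A$ counts the occurrences of each letter. For $a\in A_v$, $\mathbf q\in Q$: $t_a\mathbf q$ is $\mathbf q$ with $\mathbf q(v)$ replaced by $T_a(\mathbf q(v))$, and $\mathbf M_a(\mathbf q)=\sum_{e\text{ out of }v}|T_e(\mathbf q(v),a)|\in\mathbb N^A$. A configuration is a pair $\mathbf x.\mathbf q$ with $\mathbf x\in\mathbb Z^A$, $\mathbf q\in Q$; $\pi_a(\mathbf x.\mathbf q)=(\mathbf x+\mathbf M_a(\mathbf q)-|a|).t_a\mathbf q$. For $w=a_1\cdots a_\ell$: $t_w=t_{a_\ell}\cdots t_{a_1}$, $\mathbf M_w(\mathbf q)=\sum_i\mathbf M_{a_i}(t_{a_1\cdots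 a_{i-1}}\mathbf q)$, $\pi_w=\pi_{a_\ell}\cdots\pi_{a_1}$; these depend only on $|w|$, so $t_{\mathbf n},\mathbf M_{\mathbf n},\pi_{\mathbf n}$ are defined for $\mathbf n\in\mathbb N^A$. The word $w$ is legal for $\mathbf x.\mathbf q$ if, with $\mathbf x_i.\mathbf q_i=\pi_{a_1\cdots a_i}(\mathbf x.\mathbf q)$, $\mathbf x_{i-1}(a_i)\ge1$ for all $1\le i\le\ell$. Write $\mathbf x.\mathbf q\xrightarrow{w}\mathbf x'.\mathbf q'$ if $w$ is legal for $\mathbf x.\mathbf q$ and $\pi_w(\mathbf x.\mathbf q)=\mathbf x'.\mathbf q'$; write $\mathbf x.\mathbf q\to\mathbf x'.\mathbf q'$ if this holds for some (possibly empty) $w$. Local recurrence, kernel, production matrix. $\mathcal N$ is locally irreducible if for all $\mathbf q,\mathbf q'\in Q$ there are words $w,w'$ with $t_w\mathbf q=t_{w'}\mathbf q'$. The minimal idempotent of a finite commutative monoid is the product of all its idempotents. For $\mathcal N$ finite, $\mathrm{Loc}(\mathcal N)=e_0Q$, where $e_0$ is the minimal idempotent of the finite commutative monoid generated by the $t_a$ in $\mathrm{End}(Q)$. The total kernel is $K=\{\mathbf z\in\mathbb Z^A: t_{\mathbf z^+}\mathbf q=t_{\mathbf z^-}\mathbf q\ \forall\mathbf q\in\mathrm{Loc}(\mathcal N)\}$, with $\mathbf z^{\pm}\in\mathbb N^A$ the positive/negative parts of $\mathbf z$. For $\mathcal N$ finite and locally irreducible, the production matrix $P$ is the unique rational $A\times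 A$ matrix with $P\mathbf k=\mathbf M_{\mathbf k}(\mathbf q)$ for all $\mathbf k\in K\cap\mathbb N^A$ and $\mathbf q\in\mathrm{Loc}(\mathcal N)$. Such a network is subcritical if the spectral radius of $P$ is less than $1$. Components. Two configurations are legally related if there is $\mathbf x_3.\mathbf q_3$ with $\mathbf x_1.\mathbf q_1\to\mathbf x_3.\mathbf q_3$ and $\mathbf x_2.\mathbf q_2\to\mathbf x_3.\mathbf q_3$ (an equivalence relation). A component of the trajectory digraph (the digraph on configurations with an $a$-labelled edge whenever $\mathbf x.\mathbf q\xrightarrow{a}\mathbf x'.\mathbf q'$) is an equivalence class of this relation; $\overline{\mathbf x.\mathbf q}$ is the component of $\mathbf x.\mathbf q$. An infinite walk is a sequence of configurations $\mathbf x_i.\mathbf q_i$ and letters $a_i$ with $\mathbf x_{i-1}.\mathbf q_{i-1}\xrightarrow{a_i}\mathbf x_i.\mathbf q_i$ for consecutive indices in $I$, where $I$ is $\mathbb Z_{\le0}$, $\mathbb Z_{\ge0}$ or $\mathbb Z$; it is diverse if each letter $a\in A$ equals $a_i$ for infinitely many $i$. A component is recurrent if it contains a diverse infinite walk. $\overline{\mathrm{Rec}}(\mathcal N)$ is the set of recurrent components. Shift monoid and torsion group. $\mathbb N^A$ acts on $\overline{\mathrm{Rec}}(\mathcal N)$ by $\phi(\mathbf n)(\overline{\mathbf x.\mathbf q})=\overline{(\mathbf x+\mathbf n).\mathbf q}$; the shift monoid is $\mathscr M(\mathcal N)=\phi(\mathbb N^A)$. $\mathrm{Tor}(\mathcal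 N)$ is the torsion subgroup of the Grothendieck group of $\mathscr M(\mathcal N)$ (classes $\overline{(m,m')}$ of pairs, $(m_1,m_1')\sim(m_2,m_2')$ iff $mm_1m_2'=mm_1'm_2$ for some $m$). A recurrent component $\overline{\mathbf x.\mathbf q}$ is invertible if for every $g\in\mathrm{Tor}(\mathcal N)$ there is a recurrent component $\overline{\mathbf x'.\mathbf q'}$ such that $\overline{(\mathbf x+\mathbf n).\mathbf q}=\overline{(\mathbf x'+\mathbf n').\mathbf q'}$ for all $\mathbf n,\mathbf n'\in\mathbb N^A$ with $g=\overline{(\phi(\mathbf n),\phi(\mathbf n'))}$; $\overline{\mathrm{Rec}}(\mathcal N)^\times$ is the set of invertible ones, and $\mathrm{Tor}(\mathcal N)$ acts on it by $g\cdot\overline{\mathbf x.\mathbf q}=\overline{\mathbf x'.\mathbf q'}$. Global monoid (subcritical case). A configuration $\mathbf x.\mathbf q$ is stable if $\mathbf x\le\mathbf 0$; in a finite, locally irreducible, subcritical network every component contains a unique stable configuration. $\mathscr Q$ is the (finite) set of components whose stable configuration is of the form $\mathbf 0.\mathbf q$, $\mathbf q\in Q$. $\mathbb N^A$ acts on $\mathscr Q$ by $\Phi(\mathbf n)(\overline{\mathbf 0.\mathbf q})=\overline{\mathbf n.\mathbf q}$, and the global monoid is $\mathscr F(\mathcal S)=\Phi(\mathbb N^A)\subseteq\mathrm{End}(\mathscr Q)$, a finite commutative monoid; $e\mathscr F(\mathcal S)$ is a finite abelian group with identity $e$ (called the critical group). The set $\overline{\mathrm{Rec}}(\mathcal S)$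 is a subset of $\mathscr Q$ closed under the action of $\mathscr F(\mathcal S)$. *)

(* Defs.v *)
From mathcomp Require Import all_boot all_order all_algebra all_field.
From mathcomp Require Import finmap all_classical.
Set Implicit Arguments.
Unset Strict Implicit.
Unset Printing Implicit Defensive.
Import Order.TTheory GRing.Theory Num.Theory.
Local Open Scope classical_set_scope.
Local Open Scope ring_scope.

Section MapMonoids.
Variable X : choiceType.

(* A monoid of self-maps of X is given by its set of elements; the law is
   composition.  For a subset Y of X, an element of End(Y) is encoded as a
   self-map of X that is the identity outside Y, i.e. as [patch id Y f], so
   that equality and composition in End(Y) are those of X -> X; in particular
   the identity of End(Y) is [id]. *)
Implicit Types (M : set (X -> X)) (f m : X -> X).

(* The product of all idempotents of M.  The order of the factors is
   irrelevant when M is commutative, and the definition is only meaningful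
   when M is finite ([fset_set] of an infinite set is empty). *)
Definition minimal_idempotent M : X -> X :=
  \big[comp/id]_(f <- fset_set [set f | M f /\ f \o f = f]) f.

(* Grothendieck group of M: a class is the set of pairs equivalent to a given
   one, and the product of two classes is obtained by multiplying
   representatives. *)
Definition groth_class M m m' : set ((X -> X) * (X -> X)) :=
  [set p | [/\ M p.1, M p.2 &
     exists2 k, M k & k \o m \o p.2 = k \o p.1 \o m']].

Definition groth M : set (set ((X -> X) * (X -> X))) :=
  [set groth_class M m m' | m in M & m' in M].

Definition groth_mul M (g h : set ((X -> X) * (X -> X))) :=
  [set r | exists p p', [/\ g p, h p' &
     groth_class M (p.1 \o p'.1) (p.2 \o p'.2) r]].

Definition groth_one M := groth_class M id id.

Definition torsion M : set (set ((X -> X) * (X -> X))) :=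
  [set g | groth M g /\
     exists2 k, (0 < k)%N & iter k (groth_mul M g) (groth_one M) = groth_one M].

End MapMonoids.

Definition is_group T (G : set T) (op : T -> T -> T) (one : T) : Prop :=
  [/\ G one,
      forall x y, G x -> G y -> G (op x y),
      forall x y z, G x -> G y -> G z -> op x (op y z) = op (op x y) z,
      forall x, G x -> op one x = x /\ op x one = x &
      forall x, G x -> exists y, [/\ G y, op y x = one & op x y = one]].

Definition is_group_isomorphism T T'
    (G : set T) (op : T -> T -> T) (one : T)
    (G' : set T') (op' : T' -> T' -> T') (one' : T') (f : T -> T') : Prop :=
  [/\ is_group G op one, is_group G' op' one', set_bij G G' f &
      forall x y, G x -> G y -> f (op x y) = op' (f x) (f y)].

(* The roots of the characteristic polynomial are taken in algC, which contains
   all eigenvalues of a rational matrix. *)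
Definition spectral_radius n (P : 'M[rat]_n) : algC :=
  \big[Num.max/0]_(z <- sval (closed_field_poly_normal
                                (char_poly (map_mx ratr P)))) `|z|.

(* Finite directed multigraph: [edge v u] is the set of edges from v to u.
   The vertex set is nonempty, as usual for graphs; without vertices there would
   be no letters, hence no infinite walks. *)
Record digraph := Digraph {
  vertex : finType;
  edge : vertex -> vertex -> finType;
  vertex_gt0 : (0 < #|vertex|)%N }.

(* The message function of an edge from v to u maps Q_v * A_v to words over A_u.
   The alphabets are made disjoint by tagging, see [letter]. *)
Record finite_abelian_network (G : digraph) := FiniteAbelianNetwork {
  alph : vertex G -> finType;
  state : vertex G -> finType;
  trans : forall v, alph v -> state v -> state v;
  msg : forall v u, edge v u -> state v -> alph v -> seq (alph u);
  alph_gt0 : forall v, (0 < #|alph v|)%N;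
  state_gt0 : forall v, (0 < #|state v|)%N;
  trans_comm : forall v (a b : alph v) (q : state v),
    trans a (trans b q) = trans b (trans a q);
  msg_comm : forall v u (e : edge v u) (a b : alph v) (q : state v),
    perm_eq (msg e q a ++ msg e (trans a q) b)
            (msg e q b ++ msg e (trans b q) a) }.

Section Network.
Variables (G : digraph) (N : finite_abelian_network G).

Definition letter : finType := {v : vertex G & alph N v}.
Definition states : finType := {dffun forall v : vertex G, state N v}.
Notation natvec := {ffun letter -> nat}.
Notation intvec := {ffun letter -> int}.
Definition config : Type := intvec * states.

Implicit Types (a b : letter) (w : seq letter) (q : states) (n : natvec).
Implicit Types (c : config) (C : set config).

Definition wcount w : natvec := [ffun a => count_mem a w].
Definition zvec n : intvec := [ffun a => (n a)%:Z].
(* A word in which each letter a occurs n a times. *)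
Definition word_of n : seq letter := flatten [seq nseq (n a) a | a <- enum letter].

Definition act a q : states :=
  [ffun v => dfwith q (tag a) (trans (tagged a) (q (tag a))) v].
Definition messages a q : natvec :=
  \sum_(u : vertex G) \sum_(e : edge (tag a) u)
    wcount [seq Tagged (fun v => alph N v) x | x <- msg e (q (tag a)) (tagged a)].
Definition fire a c : config :=
  (c.1 + zvec (messages a c.2) - zvec (wcount [:: a]), act a c.2).

Definition actw w q : states := foldl (fun q a => act a q) q w.
Fixpoint messagesw w q : natvec :=
  if w is a :: w' then messages a q + messagesw w' (act a q) else 0.
Definition firew w c : config := foldl (fun c a => fire a c) c w.

(* [actw w] and [messagesw w] depend only on the letter counts of w. *)
Definition actn n q : states := actw (word_of n) q.
Definition messagesn n q : natvec := messagesw (word_of n) q.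

Definition legal_letter a c : Prop := 1 <= c.1 a.
Fixpoint legal w c : Prop :=
  if w is a :: w' then legal_letter a c /\ legal w' (fire a c) else True.
Definition leads c c' : Prop := exists w, legal w c /\ firew w c = c'.

Definition locally_irreducible : Prop :=
  forall q q', exists w w', actw w q = actw w' q'.

Definition local_monoid : set (states -> states) := range actw.
Definition loc : set states := range (minimal_idempotent local_monoid).

Definition pos_part (z : intvec) : natvec := [ffun a => `|Num.max (z a) 0|%N].
Definition neg_part (z : intvec) : natvec := [ffun a => `|Num.max (- z a) 0|%N].
Definition total_kernel : set intvec :=
  [set z | forall q, loc q -> actn (pos_part z) q = actn (neg_part z) q].

Definition colvec n : 'cV[rat]_#|letter| := \col_i (n (enum_val i))%:R.
Definition is_production_matrix (P : 'M[rat]_#|letter|) : Prop :=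
  forall n q, total_kernel (zvec n) -> loc q ->
    P *m colvec n = colvec (messagesn n q).

(* The production matrix of a locally irreducible network exists and is
   unique. *)
Definition subcritical : Prop :=
  exists2 P, is_production_matrix P & spectral_radius P < 1.

Definition legally_related c1 c2 : Prop :=
  exists2 c3, leads c1 c3 & leads c2 c3.
Definition component c : set config := [set c' | legally_related c c'].
Definition components : set (set config) := range component.

(* For consecutive indices i - 1, i of I, the letter l i labels the edge from
   x (i - 1) to x i. *)
Definition walk (I : set int) (x : int -> config) (l : int -> letter) : Prop :=
  forall i, I (i - 1) -> I i ->
    legal_letter (l i) (x (i - 1)) /\ fire (l i) (x (i - 1)) = x i.
Definition walk_indices (I : set int) : Prop :=
  [\/ I = [set i | i <= 0], I = [set i | 0 <= i] | I = setT].
Definition diverse (I : set int) (l : int -> letter) : Prop :=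
  forall a, infinite_set [set i | [/\ I (i - 1), I i & l i = a]].

Definition rec_components : set (set config) :=
  [set C | components C /\ exists I x l,
     [/\ walk_indices I, walk I x l, diverse I l & forall i, I i -> C (x i)]].

(* The image of the component of x.q is the component of (x + n).q; the union
   over all members of a component is a union of equal sets. *)
Definition shift n C : set config :=
  \bigcup_(c in C) component (c.1 + zvec n, c.2).

Definition shift_rec n : set config -> set config :=
  patch id rec_components (shift n).
Definition shift_monoid : set (set config -> set config) := range shift_rec.
Definition tor := torsion shift_monoid.

Definition tor_related g C C' : Prop :=
  rec_components C' /\
  forall n n', g = groth_class shift_monoid (shift_rec n) (shift_rec n') ->
    shift n C = shift n' C'.
Definition invertible_components : set (set config) :=
  [set C | rec_components C /\ forall g, tor g -> exists C', tor_related g C C'].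
(* The default value [set0] is not a component. *)
Definition tor_act g C : set config := xget set0 [set C' | tor_related g C C'].

Definition stable : set config := [set c : config | forall a, c.1 a <= 0].
Definition gstates : set (set config) :=
  [set C | components C /\ exists q, C `&` stable = [set (0, q)]].

Definition global_act n : set config -> set config :=
  patch id gstates (shift n).
Definition global_monoid : set (set config -> set config) := range global_act.

Definition critical_group : set (set config -> set config) :=
  [set minimal_idempotent global_monoid \o m | m in global_monoid].

(* The endomorphism of the set of recurrent components, a subset of [gstates],
   induced by an element of the global monoid. *)
Definition eta (m : set config -> set config) : set config -> set config :=
  patch id rec_components m.

End Network.

Arguments gstates {G} N _.
Arguments rec_components {G} N _.
Arguments invertible_components {G} N _.
Arguments shift_monoid {G} N _.
Arguments global_monoid {G} N _.
Arguments critical_group {G} N _.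
Arguments tor {G} N _.
Arguments eta {G} N m _.
Arguments tor_act {G} N g C _.

(* Main.v *)
Require Import Defs.
From mathcomp Require Import all_boot all_order all_algebra all_field.
From mathcomp Require Import finmap all_classical zify ring.
Set Implicit Arguments.
Unset Strict Implicit.
Unset Printing Implicit Defensive.
Import Order.TTheory GRing.Theory Num.Theory.
Local Open Scope classical_set_scope.

(* Subcriticality is used only to produce vectors k, y with y >= 1 in every
   letter such that, from any locally recurrent state, firing k (possibly
   illegally) restores the state and just removes the letters y: truncating the
   series (I - P)^-1 = 1 + P + P^2 + ... gives such a k, since P^j -> 0 by
   Cayley-Hamilton.
   If w is legal for c, then what remains of w after deleting a word u is legal
   for the configuration obtained by firing u. With u made of many copies of k,
   that configuration is stable, so the length of w is bounded. Deleting one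
   copy of k from a long word w that leads into a recurrent component C shows
   that C is fixed by the shift by y. Conversely, a component of a 0.q fixed by
   some n >= 1 contains a periodic backward walk ... -> 2n.q -> n.q -> 0.q.
   Hence the recurrent components are those fixed by e; on them every shift has
   finite order, so the shift monoid is a finite group, equal to its own
   Grothendieck group and isomorphic to the critical group by restriction. *)

(** * Nonnegative matrices of spectral radius less than 1 *)

Section Spectral.
Local Open Scope ring_scope.

(** Induction on [s]: with [u = A v - z v], the orbits satisfy [A^(k+1) v = z A^k v + A^k u], so a
    bound [B] for the orbit of [u] gives the bound [(|v| + B) / (1 - |z|)] for that of [v]. *)
Lemma orbit_norm_summable (R : numFieldType) n (A : 'M[R]_n) (s : seq R)
    (v : 'cV[R]_n) :
  all (fun z => `|z| < 1) s ->
  foldl (fun u z => A *m u - z *: u) v s = 0 ->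
  exists B, forall K,
    \sum_(j < K) \sum_i `|iter j (mulmx A) v i 0| <= B.
Proof.
elim: s v => [|z s IHs] v /=.
  move=> _ ->; exists 0 => K; rewrite big1 // => j _.
  have -> : iter j (mulmx A) 0 = 0 :> 'cV[R]_n.
    by elim: (j : nat) => //= k ->; rewrite mulmx0.
  by rewrite big1 // => i _; rewrite mxE normr0.
move=> /andP[z1 s1] /(IHs _ s1)[B leB].
set u := A *m v - z *: v in leB.
have iterS k : iter k.+1 (mulmx A) v
    = z *: iter k (mulmx A) v + iter k (mulmx A) u.
  elim: k => [|k IHk] /=; first by rewrite /u addrC subrK.
  by rewrite /= in IHk; rewrite {1}IHk mulmxDr -scalemxAr.
have z1' : 0 < 1 - `|z| by rewrite subr_gt0.
exists ((\sum_i `|v i 0| + B) / (1 - `|z|)) => K.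
rewrite ler_pdivlMr // mulrBr mulr1 lerBlDr.
have le0 k : 0 <= \sum_i `|iter k (mulmx A) v i 0|.
  by apply: sumr_ge0.
apply: (@le_trans _ _ (\sum_(j < K.+1) \sum_i `|iter j (mulmx A) v i 0|)).
  by rewrite big_ord_recr /= lerDl.
rewrite big_ord_recl /= -addrA; apply: lerD => //.
apply: le_trans (lerD (leB K) (lexx _)).
rewrite mulr_suml -big_split /=; apply: ler_sum => j _.
rewrite mulr_suml -big_split /=; apply: ler_sum => i _.
have /= -> := iterS j.
rewrite mxE addrC (le_trans (ler_normD _ _)) // lerD2l.
by rewrite mxE normrM mulrC.
Qed.

(** The fold multiplies [v] by the product of the [A - z] over the roots [z] of the characteristic
    polynomial, which vanishes by Cayley-Hamilton. *)
Lemma foldl_char_poly n (A : 'M[algC]_n) (v : 'cV[algC]_n) :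
  foldl (fun u z => A *m u - z *: u) v
    (sval (closed_field_poly_normal (char_poly A))) = 0.
Proof.
case: closed_field_poly_normal => s /= /[1!(monicP (char_poly_monic A))].
rewrite scale1r; case: n A v => [|n] A v defA.
  by apply/matrixP => -[].
have fold_horner (u : 'cV[algC]_n.+1) r :
    foldl (fun u z => A *m u - z *: u) u r
    = horner_mx A (\prod_(z <- r) ('X - z%:P)) *m u.
  elim: r u => [|z r IHr] u; first by rewrite big_nil rmorph1 mul1mx.
  rewrite /= IHr big_cons mulrC rmorphM rmorphB /= horner_mx_X horner_mx_C.
  by rewrite -mulmxA mulmxBl mul_scalar_mx.
by rewrite fold_horner -defA Cayley_Hamilton mul0mx.
Qed.

(** The order of [algC] is partial: a bound on the maximum passes to each root because norms are
    real, hence comparable. *)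
Lemma spectral_radius_lt1 n (P : 'M[rat]_n) :
  spectral_radius P < 1 ->
  all (fun z : algC => `|z| < 1)
    (sval (closed_field_poly_normal (char_poly (map_mx ratr P)))).
Proof.
rewrite /spectral_radius; elim: (sval _) => //= z s IHs.
rewrite big_cons.
have big_real : \big[Num.max/0]_(y <- s) `|y| \is @Num.real algC.
  by apply: bigmax_real => [|i _]; [exact: real0 | exact: normr_real].
rewrite comparable_gt_max ?real_comparable ?normr_real //.
by move=> /andP[-> /IHs].
Qed.

(** Otherwise every iterate has an entry at least 1, so the first [K] iterates have total norm at
    least [K], which contradicts the uniform bound [B] for [K = Num.bound B]. *)
Lemma rat_iter_mulmx_small n (P : 'M[rat]_n) (v : 'cV[rat]_n) :
  spectral_radius P < 1 ->
  exists k, forall i, iter k (mulmx P) v i 0 < 1.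
Proof.
move=> /spectral_radius_lt1 root_lt1.
have [B leB] := orbit_norm_summable root_lt1 (foldl_char_poly _ (map_mx ratr v)).
have B0 : 0 <= B by have := leB 0%N; rewrite big_ord0.
apply: contrapT => small; have := leB (Num.bound B).
suff : (Num.bound B)%:R <= \sum_(j < Num.bound B) \sum_i
    `|iter j (mulmx (map_mx ratr P)) (map_mx ratr v) i 0| :> algC.
  by move=> /le_trans /[apply] /(lt_le_trans (archi_boundP B0)); rewrite ltxx.
rewrite -[X in X%:R <= _]card_ord -sum1_card natr_sum; apply: ler_sum => j _.
have iterE : iter j (mulmx (map_mx ratr P)) (map_mx ratr v)
    = map_mx ratr (iter j (mulmx P) v) :> 'cV[algC]_n.
  by elim: (j : nat) => //= k ->; rewrite map_mxM.
have [i] : exists i, 1 <= iter j (mulmx P) v i 0.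
  apply: contrapT => nle; apply: small; exists j => i.
  by rewrite ltNge; apply/negP => ?; apply: nle; exists i.
move=> lei; rewrite (bigD1 i) //= iterE mxE.
apply: ler_wpDr; first exact: sumr_ge0.
rewrite -ratr_norm -[1](rmorph1 (ratr : rat -> algC)) ler_rat.
exact: le_trans lei (ler_norm _).
Qed.

Lemma nonneg_common_denominator n (v : 'cV[rat]_n) :
  (forall i, 0 <= v i 0) ->
  exists2 D, (0 < D)%N & exists k : 'I_n -> nat, forall i, D%:R * v i 0 = (k i)%:R.
Proof.
move=> v0; exists (\prod_i `|denq (v i 0%R)|)%N.
  by rewrite prodn_gt0 // => i; rewrite absz_gt0 denq_neq0.
exists (fun i => `|numq (v i 0%R)| * \prod_(j | j != i) `|denq (v j 0%R)|)%N => i.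
rewrite (bigD1 i) //= !natrM mulrAC; congr (_ * _).
rewrite !natr_absz gtr0_norm ?denq_gt0 // ger0_norm ?numq_ge0 //.
by rewrite mulrC numqE.
Qed.

(* The vector is a truncated Neumann series: if [P^K 1 < 1], then
   [v = 1 + P 1 + ... + P^(K-1) 1] satisfies [v - P v = 1 - P^K 1 > 0]. *)
Lemma subinvariant_vector n (P : 'M[rat]_n) m :
  (0 < m)%N -> (forall i j, 0 <= P i j) -> spectral_radius P < 1 ->
  exists k : 'I_n -> nat, forall i,
    (P *m \col_j (m * k j)%:R) i 0 < (m * k i)%:R.
Proof.
pose one : 'cV[rat]_n := const_mx 1.
move=> m0 P0 /(rat_iter_mulmx_small one)[K smallK].
pose v : 'cV_n := \sum_(j < K) iter j (mulmx P) one.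
have iter0 j i : 0 <= iter j (mulmx P) one i 0.
  elim: j i => [|j IHj] i /=; first by rewrite mxE.
  by rewrite mxE sumr_ge0 // => l _; rewrite mulr_ge0.
have [D D0 [k defk]] : exists2 D, (0 < D)%N &
    exists k : 'I_n -> nat, forall i, D%:R * v i 0 = (k i)%:R.
  apply: nonneg_common_denominator => i; rewrite summxE.
  by rewrite sumr_ge0.
have Pv i : (P *m v) i 0 < v i 0.
  rewrite -subr_gt0.
  suff -> : v i 0 - (P *m v) i 0 = 1 - iter K (mulmx P) one i 0.
    by rewrite subr_gt0.
  rewrite /v mulmx_sumr; elim: {smallK v defk}K => [|K IHK].
    by rewrite !big_ord0 !mxE subrr.
  rewrite !big_ord_recr /= ![(_ + _ : matrix _ _ _) _ _]mxE.
  rewrite opprD addrACA IHK; ring.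
(* The witness is [D v]. The factor [m] rescales both sides; it will make the vector act trivially
   on locally recurrent states. *)
exists k => i.
have -> : \col_j (m * k j)%:R = (m * D)%:R *: v.
  by apply/colP => j; rewrite !mxE !natrM -defk mulrA.
rewrite -scalemxAr mxE natrM [(m * k i)%:R]natrM -defk mulrA -!natrM.
by rewrite ltr_pM2l ?Pv // ltr0n muln_gt0 m0.
Qed.
End Spectral.

(** * Commutative monoids of maps *)

Definition comm_map_monoid (X : Type) (M : set (X -> X)) : Prop :=
  [/\ M id, forall f g, M f -> M g -> M (f \o g) &
      forall f g, M f -> M g -> f \o g = g \o f].

Section CommutativeMapMonoid.
Variables (X : choiceType) (M : set (X -> X)).
Hypothesis M_monoid : comm_map_monoid M.

Let M_id : M id. Proof. by case: M_monoid. Qed.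

Let M_comp f g : M f -> M g -> M (f \o g).
Proof. by case: M_monoid => _ + _; apply. Qed.

Let M_comm f g : M f -> M g -> f \o g = g \o f.
Proof. by case: M_monoid => _ _; apply. Qed.

Lemma map_monoid_iter f k : M f -> M (iter k f).
Proof. by move=> Mf; elim: k => //= k IHk; exact: M_comp. Qed.

Section Finite.
Hypothesis M_fin : finite_set M.

(** By the pigeonhole principle two powers of [f] coincide, so the powers are eventually
    periodic. *)
Lemma idempotent_iter f : M f ->
  exists2 k, (0 < k)%N & iter k f \o iter k f = iter k f.
Proof.
move=> Mf; pose s := [seq iter i f | i <- iota 0 (size (fset_set M)).+1].
have : ~~ uniq s.
  apply/negP => /uniq_leq_size le_s.
  have : (size s <= size (fset_set M))%N.
    apply: le_s => _ /mapP[i _ ->]; rewrite in_fset_set // inE.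
    exact: map_monoid_iter.
  by rewrite size_map size_iota ltnn.
move=> /(uniqPn (id : X -> X))[i [j [ltij]]]; rewrite size_map size_iota => ltj.
rewrite !(nth_map 0%N) ?size_iota ?(ltn_trans ltij) //.
rewrite !nth_iota ?(ltn_trans ltij) //.
rewrite !add0n => eqij; set p := (j - i)%N.
have p0 : (0 < p)%N by rewrite subn_gt0.
have per n l : (i <= n)%N -> iter (n + l * p) f = iter n f.
  move=> lein; elim: l => [|l IHl]; first by rewrite mul0n addn0.
  rewrite -[RHS]IHl mulSn addnCA addnC; apply: funext => x.
  have -> : (n + l * p + p = (n + l * p - i) + j)%N.
    rewrite /p; move: lein ltij; lia.
  rewrite iterD -eqij -iterD; congr (iter _ f x).
  by rewrite subnK // (leq_trans lein) ?leq_addr.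
(* A multiple of the period [p] that is at least [i]: doubling this exponent does not change the
   power. *)
exists (i.+1 * p)%N; first by rewrite muln_gt0.
apply: funext => x /=; rewrite -iterD per //.
by rewrite (leq_trans (leqnSn i)) // leq_pmulr.
Qed.

Local Notation e := (minimal_idempotent M).

(** Induction along the list of idempotents: by commutativity a new factor passes through the
    product of the others, which stays idempotent and absorbs it. *)
Lemma minimal_idempotentP :
  [/\ M e, e \o e = e & forall f, M f -> f \o f = f -> e \o f = e].
Proof.
have fin : finite_set [set f | M f /\ f \o f = f].
  by apply: sub_finite_set M_fin => f [].
rewrite /minimal_idempotent.
set s : seq _ := fset_set _.
have s_idem f : f \in s -> M f /\ f \o f = f.
  by rewrite in_fset_set // inE.
have s_mem f : M f -> f \o f = f -> f \in s.
  by move=> Mf ff; rewrite in_fset_set // inE.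
suff [Mb bb babs] : [/\ M (\big[comp/id]_(f <- s) f),
     \big[comp/id]_(f <- s) f \o \big[comp/id]_(f <- s) f
     = \big[comp/id]_(f <- s) f &
     forall f, f \in s ->
       \big[comp/id]_(f <- s) f \o f = \big[comp/id]_(f <- s) f].
  by split=> // f Mf /(s_mem _ Mf) /babs.
elim: (s) s_idem {s_mem} => [|f r IHr] r_idem; first by rewrite big_nil.
have [g rg|Mb bb babs] := IHr; first by apply: r_idem; rewrite inE rg orbT.
have [Mf ff] : M f /\ f \o f = f by apply: r_idem; rewrite mem_head.
rewrite big_cons; set b := \big[comp/id]_(_ <- _) _ in Mb bb babs *.
have fbf : (f \o b) \o f = f \o b.
  (* Composition is associative by conversion, so regroupings of this kind are closed by [//]. *)
  rewrite [LHS](_ : _ = f \o (b \o f)) // (M_comm Mb Mf).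
  exact: (congr1 (fun h => h \o b) ff).
split=> [|| g].
- exact: M_comp.
- rewrite [LHS](_ : _ = ((f \o b) \o f) \o b) // fbf.
  exact: (congr1 (fun h => f \o h) bb).
- rewrite inE => /predU1P[-> // | /babs bg].
  by rewrite [LHS](_ : _ = f \o (b \o g)) // bg.
Qed.

Lemma minimal_idempotent_in : M e.
Proof. by case: minimal_idempotentP. Qed.

Lemma minimal_idempotent_idem : e \o e = e.
Proof. by case: minimal_idempotentP. Qed.

Lemma minimal_idempotent_absorb f : M f -> f \o f = f -> e \o f = e.
Proof. by case: minimal_idempotentP => _ _; apply. Qed.

(** Some power of [f] is idempotent. Multiplication by [f] thus has finite order on the ideal of
    [e], the source of the inverses below. *)
Lemma minimal_idempotent_absorb_iter f :
  M f -> exists2 k, (0 < k)%N & e \o iter k f = e.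
Proof.
move=> Mf; have [k k0 kk] := idempotent_iter Mf.
by exists k => //; apply: minimal_idempotent_absorb => //; exact: map_monoid_iter.
Qed.

(** If [e m^(k+1) = e], then [e m^k] is the inverse of [e m]. *)
Lemma minimal_ideal_is_group :
  is_group [set e \o m | m in M] (fun f g => f \o g) e.
Proof.
have eK f : [set e \o m | m in M] f -> e \o f = f /\ f \o e = f.
  move=> [m Mm <-]; split.
    exact: (congr1 (fun h => h \o m) minimal_idempotent_idem).
  rewrite [LHS](_ : _ = e \o (m \o e)) // (M_comm Mm minimal_idempotent_in).
  by rewrite -[RHS](congr1 (fun h => h \o m) minimal_idempotent_idem).
split=> //.
- by exists id.
- move=> _ _ [f Mf <-] [g Mg <-]; exists (f \o (e \o g)) => //.
  by do 2![apply: M_comp => //]; exact: minimal_idempotent_in.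
- move=> _ [m Mm <-].
  have [[|k] // _ kk] := minimal_idempotent_absorb_iter Mm.
  have [Me ee] := (minimal_idempotent_in, minimal_idempotent_idem).
  have Mk : M (iter k m) by exact: map_monoid_iter.
  exists (e \o iter k m); split; first by exists (iter k m).
    rewrite [LHS](_ : _ = e \o ((iter k m \o e) \o m)) // (M_comm Mk Me).
    rewrite [LHS](_ : _ = (e \o e) \o (iter k m \o m)) // ee (M_comm Mk Mm).
    exact: kk.
  rewrite [LHS](_ : _ = e \o ((m \o e) \o iter k m)) // (M_comm Mm Me).
  by rewrite [LHS](_ : _ = (e \o e) \o (m \o iter k m)) // ee.
Qed.
End Finite.

(** * Grothendieck group of a commutative torsion group of maps *)

Section GrothendieckGroup.
Hypothesis M_tor : forall f, M f -> exists2 k, (0 < k)%N & iter k f = id.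

Let M_inv f : M f -> exists2 g, M g & g \o f = id.
Proof.
move=> Mf; have [[|k] // _ fk] := M_tor Mf.
have Mk : M (iter k f) by exact: map_monoid_iter.
by exists (iter k f) => //; rewrite (M_comm Mk Mf).
Qed.

(** Torsion makes every element invertible, so the factor [k] in the equivalence of pairs
    cancels. *)
Lemma groth_classE m m' : M m -> M m' ->
  groth_class M m m' =
    [set p | [/\ M p.1, M p.2 & m \o p.2 = p.1 \o m']].
Proof.
move=> Mm Mm'; apply/seteqP; split=> -[f g] [/= Mf Mg]; last first.
  by move=> eqfg; split => //; exists id.
move=> [k Mk eqk]; split=> //; have [k' Mk' k'k] := M_inv Mk.
have := congr1 (fun h => k' \o h) eqk.
by rewrite -[LHS]/((k' \o k) \o (m \o g)) -[RHS]/((k' \o k) \o (f \o m')) k'k.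
Qed.

Lemma groth_class_mem m m' : M m -> M m' -> groth_class M m m' (m, m').
Proof. by move=> Mm Mm'; rewrite groth_classE. Qed.

(** Normal form: multiplication by the inverse [f] of [m'] turns the pair [(m, m')] into
    [(f \o m, id)]. *)
Lemma groth_class_quotient m m' : M m -> M m' ->
  exists2 f, M f & groth_class M m m' = groth_class M f id.
Proof.
move=> Mm Mm'; have [f Mf fm'] := M_inv Mm'.
have Mfm := M_comp Mf Mm.
exists (f \o m) => //; rewrite !groth_classE //.
apply/seteqP; split=> -[g h] [/= Mg Mh eqgh]; split=> //=.
  rewrite [LHS](_ : _ = f \o (m \o h)) // eqgh (M_comm Mg Mm').
  by rewrite [LHS](_ : _ = (f \o m') \o g) // fm'.
have := congr1 (fun k => m' \o k) eqgh.
rewrite -[LHS]/((m' \o f) \o (m \o h)) (M_comm Mm' Mf) fm' => eqmh.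
by rewrite -[LHS]/(id \o (m \o h)) eqmh; exact: (M_comm Mm' Mg).
Qed.

Lemma groth_class_inj f g : M f -> M g ->
  groth_class M f id = groth_class M g id -> f = g.
Proof.
move=> Mf Mg eqfg; have := groth_class_mem Mf M_id.
by rewrite eqfg groth_classE // => -[].
Qed.

Lemma groth_mul_class f g : M f -> M g ->
  groth_mul M (groth_class M f id) (groth_class M g id)
  = groth_class M (f \o g) id.
Proof.
move=> Mf Mg; apply/seteqP; split => r.
  move=> [[a b] [[a' b'] []]].
  rewrite (groth_classE Mf M_id) (groth_classE Mg M_id).
  move=> [/= Ma Mb fb] [/= Ma' Mb' gb'].
  rewrite groth_classE; [|exact: M_comp..].
  have -> : a = f \o b by [].
  have -> : a' = g \o b' by [].
  move=> [Mr1 Mr2 eqr]; split=> //.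
  (* The factor to cancel is [b \o b'], since the representatives are [(f \o b, b)] and
     [(g \o b', b')]. *)
  have [c Mc cb] := M_inv (M_comp Mb Mb').
  have eqd : (f \o b) \o (g \o b') = (b \o b') \o (f \o g).
    rewrite (M_comm (M_comp Mb Mb') (M_comp Mf Mg)).
    by rewrite [LHS](_ : _ = f \o (b \o g) \o b') // (M_comm Mb Mg).
  rewrite eqd (M_comm Mr1 (M_comp Mb Mb')) in eqr.
  have := congr1 (fun k => c \o k) eqr.
  rewrite -[LHS]/((c \o (b \o b')) \o (f \o g \o r.2)).
  by rewrite -[RHS]/((c \o (b \o b')) \o r.1) cb => eqc; exists id.
move=> fgr; exists (f, id), (g, id); split=> //; exact: groth_class_mem.
Qed.

Lemma torsion_class f : M f -> torsion M (groth_class M f id).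
Proof.
move=> Mf; split; first by exists f => //; exists id.
have [k k0 fk] := M_tor Mf; exists k => //.
rewrite -[RHS](congr1 (fun h => groth_class M h id) fk) {k0 fk}.
elim: k => //= k ->; rewrite groth_mul_class //; exact: map_monoid_iter.
Qed.

Lemma torsionP g : torsion M g -> exists2 f, M f & g = groth_class M f id.
Proof.
by move=> [[m Mm [m' Mm' <-]] _]; exact: groth_class_quotient.
Qed.

Lemma torsion_is_group : is_group (torsion M) (groth_mul M) (groth_one M).
Proof.
split.
- exact: torsion_class.
- move=> _ _ /torsionP[f Mf ->] /torsionP[g Mg ->].
  by rewrite groth_mul_class //; apply: torsion_class; exact: M_comp.
- move=> _ _ _ /torsionP[f Mf ->] /torsionP[g Mg ->] /torsionP[h Mh ->].
  by rewrite !groth_mul_class //; exact: M_comp.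
- by move=> _ /torsionP[f Mf ->]; rewrite /groth_one !groth_mul_class.
- move=> _ /torsionP[f Mf ->]; have [g Mg gf] := M_inv Mf.
  exists (groth_class M g id); split; first exact: torsion_class.
    by rewrite groth_mul_class // gf.
  by rewrite groth_mul_class // (M_comm Mf Mg) gf.
Qed.
End GrothendieckGroup.
End CommutativeMapMonoid.

(** * Firing and legal words *)

Section NetworkDynamics.
Local Open Scope ring_scope.
Variables (G : digraph) (N : finite_abelian_network G).
Local Notation natvec := {ffun letter N -> nat}.
Local Notation tagl a := (Tagged (fun v => alph N v) a).
Implicit Types (a b : letter N) (w u : seq (letter N)) (q : states N).
Implicit Types (n : natvec) (c d : config N) (C : set (config N)).

Lemma act_at a q : act a q (tag a) = trans (tagged a) (q (tag a)).
Proof. by rewrite ffunE dfwithin. Qed.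

Lemma act_away a q v : tag a != v -> act a q v = q v.
Proof. by move=> av; rewrite ffunE dfwithout. Qed.

Lemma act_comm a b q : act a (act b q) = act b (act a q).
Proof.
apply/ffunP => v; case: a b => [va a] [vb b].
case: (eqVneq va v) => [eqa | nea]; case: (eqVneq vb v) => [eqb | neb].
- subst va vb; rewrite (act_at (tagl a)) (act_at (tagl b)).
  by rewrite (act_at (tagl b)) (act_at (tagl a)) trans_comm.
- subst va; rewrite (act_at (tagl a)) !(act_away (a := tagl b) _ neb).
  by rewrite (act_at (tagl a)).
- subst vb; rewrite (act_at (tagl b)) !(act_away (a := tagl a) _ nea).
  by rewrite (act_at (tagl b)).
- rewrite !(act_away (a := tagl a) _ nea) !(act_away (a := tagl b) _ neb).
  by rewrite !(act_away (a := tagl a) _ nea).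
Qed.

Lemma wcount_cat w u : wcount (w ++ u) = wcount w + wcount u.
Proof. by apply/ffunP => a; rewrite !ffunE count_cat. Qed.

Lemma wcount_perm w u : perm_eq w u -> wcount w = wcount u.
Proof. by move=> /permP eqwu; apply/ffunP => a; rewrite !ffunE eqwu. Qed.

Lemma messages_local a q q' :
  q (tag a) = q' (tag a) -> messages a q = messages a q'.
Proof. by rewrite /messages => ->. Qed.

(** At distinct vertices neither letter changes the state read by the other; at a common vertex this
    is [msg_comm], edge by edge. *)
Lemma messages_comm a b q :
  messages a q + messages b (act a q) = messages b q + messages a (act b q).
Proof.
have [eqab | neab] := eqVneq (tag a) (tag b); last first.
  rewrite addrC; congr (_ + _); apply: messages_local; rewrite act_away //.
  by rewrite eq_sym.
case: a b eqab => [v a] [vb b] /= eqv; subst vb.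
rewrite /messages /= (act_at (tagl a)) (act_at (tagl b)) /=.
rewrite -!big_split; apply: eq_bigr => u _ /=.
rewrite -!big_split; apply: eq_bigr => e _ /=.
by rewrite -!wcount_cat -!map_cat; apply/wcount_perm/perm_map/msg_comm.
Qed.

Lemma natvecDE n n' a : (n + n') a = (n a + n' a)%N.
Proof. by rewrite ffunE. Qed.

Lemma natvecMnE n k a : (n *+ k) a = (n a * k)%N.
Proof.
elim: k => [|k IHk]; first by rewrite mulr0n ffunE muln0.
by rewrite mulrS natvecDE IHk mulnS.
Qed.

Lemma zvecD n n' : zvec (n + n') = zvec n + zvec n'.
Proof. by apply/ffunP => a; rewrite !ffunE. Qed.

Lemma zvec0 : zvec (0 : natvec) = 0.
Proof. by apply/ffunP => a; rewrite !ffunE. Qed.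

Lemma messages_commE a b q x :
  (messages a q x + messages b (act a q) x
   = messages b q x + messages a (act b q) x)%N.
Proof. by rewrite -!natvecDE messages_comm. Qed.

Lemma config_eq c d : (forall x, c.1 x = d.1 x) -> c.2 = d.2 -> c = d.
Proof. by case: c d => [x q] [y r] /= /ffunP-> ->. Qed.

Lemma fire2 a c : (fire a c).2 = act a c.2.
Proof. by []. Qed.

Lemma fireE a c x :
  (fire a c).1 x = c.1 x + (messages a c.2 x)%:Z - (a == x)%:Z.
Proof. by rewrite !ffunE /= addn0. Qed.

Lemma fire_comm a b c : fire a (fire b c) = fire b (fire a c).
Proof.
apply: config_eq => [x|]; last exact: act_comm.
by rewrite !fireE !fire2; have := messages_commE a b c.2 x; lia.
Qed.

Lemma actw_cat w u q : actw (w ++ u) q = actw u (actw w q).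
Proof. exact: foldl_cat. Qed.

Lemma firew_cat w u c : firew (w ++ u) c = firew u (firew w c).
Proof. exact: foldl_cat. Qed.

Lemma firew_rcons w a c : firew (rcons w a) c = fire a (firew w c).
Proof. exact: foldl_rcons. Qed.

Lemma firew2 w c : (firew w c).2 = actw w c.2.
Proof. by elim: w c => //= a w IHw c; rewrite IHw. Qed.

Lemma firewE w c x :
  (firew w c).1 x
  = c.1 x + (messagesw w c.2 x)%:Z - (count_mem x w)%:Z.
Proof.
elim: w c => [|a w IHw] c /=; first by rewrite ffunE; lia.
rewrite IHw fireE fire2 natvecDE. by rewrite !PoszD; ring.
Qed.

Lemma actw_fire a w q : actw w (act a q) = act a (actw w q).
Proof. by elim: w q => //= b w IHw q; rewrite act_comm IHw. Qed.

Lemma actw_comm w u q : actw w (actw u q) = actw u (actw w q).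
Proof. by elim: u q => //= a u IHu q; rewrite IHu actw_fire. Qed.

Lemma firew_rem a w c : a \in w -> firew (rem a w) (fire a c) = firew w c.
Proof.
elim: w c => //= b w IHw c; rewrite inE eq_sym.
by case: eqP => [-> | _ /= aw] //; rewrite fire_comm IHw.
Qed.

Lemma firew_perm w u c : perm_eq w u -> firew w c = firew u c.
Proof.
elim: w u c => [|a w IHw] u c; first by rewrite perm_sym => /perm_nilP ->.
move=> eqwu; have au : a \in u by rewrite -(perm_mem eqwu) mem_head.
rewrite -(firew_rem _ au) /=; apply: IHw.
by rewrite -(perm_cons a) (perm_trans eqwu) // perm_to_rem.
Qed.

(** * Legal words, confluence and components *)

Lemma legal_cat w u c : legal (w ++ u) c <-> legal w c /\ legal u (firew w c).
Proof.
elim: w c => [|a w IHw] c /=; first by split=> [|[]].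
by rewrite IHw; split=> [[? []] | [[]]].
Qed.

Lemma leads_refl c : leads c c.
Proof. by exists [::]. Qed.

Lemma leads_trans c1 c2 c3 : leads c1 c2 -> leads c2 c3 -> leads c1 c3.
Proof.
move=> [w [lw <-]] [u [lu <-]]; exists (w ++ u).
by rewrite firew_cat; split=> //; apply/legal_cat.
Qed.

(** Firing [b] in advance, even illegally, lowers no entry but that of [b], and the deleted
    occurrence of [b] makes up for it. *)
Lemma legal_rem b w c : legal w c -> legal (rem b w) (fire b c).
Proof.
elim: w c => //= a w IHw c [la lw]; case: eqVneq => [<- // | neab] /=.
split; last by rewrite fire_comm; exact: IHw.
by move: la; rewrite /legal_letter fireE eq_sym (negPf neab); lia.
Qed.

(** The residual of [w] after [u]: a truncated difference of multisets that keeps the order of the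
    remaining letters. *)
Definition wdiff w u := foldl (fun w a => rem a w) w u.

Lemma legal_wdiff w u c : legal w c -> legal (wdiff w u) (firew u c).
Proof. by elim: u w c => //= a u IHu w c lw; apply/IHu/legal_rem. Qed.

Lemma count_wdiff w u a :
  count_mem a (wdiff w u) = (count_mem a w - count_mem a u)%N.
Proof.
elim: u w => [|b u IHu] w /=; first by rewrite subn0.
by rewrite IHu count_mem_rem subnDA.
Qed.

(** Both sides contain each letter as often as the larger of its counts in [w] and [u]. *)
Lemma wdiff_perm w u : perm_eq (w ++ wdiff u w) (u ++ wdiff w u).
Proof.
by apply/allP => a _; rewrite /= !count_cat !count_wdiff -!maxnE maxnC.
Qed.

Lemma firew_wdiff w u c :
  firew (wdiff u w) (firew w c) = firew (wdiff w u) (firew u c).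
Proof. by rewrite -!firew_cat; exact/firew_perm/wdiff_perm. Qed.

(** Each word is completed by the residual of the other, which is still legal. *)
Lemma leads_confluent c c1 c2 : leads c c1 -> leads c c2 ->
  exists2 c3, leads c1 c3 & leads c2 c3.
Proof.
move=> [w [lw <-]] [u [lu <-]]; exists (firew (wdiff u w) (firew w c)).
  by exists (wdiff u w); split=> //; exact: legal_wdiff.
by exists (wdiff w u); split; [exact: legal_wdiff | rewrite firew_wdiff].
Qed.

Lemma related_refl c : legally_related c c.
Proof. by exists c; exact: leads_refl. Qed.

Lemma related_sym c d : legally_related c d -> legally_related d c.
Proof. by move=> [c' ? ?]; exists c'. Qed.

Lemma leads_related c d : leads c d -> legally_related c d.
Proof. by move=> cd; exists d => //; exact: leads_refl. Qed.

Lemma related_trans c2 c1 c3 :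
  legally_related c1 c2 -> legally_related c2 c3 -> legally_related c1 c3.
Proof.
move=> [d l1 l2] [d' l2' l3]; have [d'' ld ld'] := leads_confluent l2 l2'.
by exists d''; [exact: leads_trans ld | exact: leads_trans ld'].
Qed.

Lemma component_mem c : component c c.
Proof. exact: related_refl. Qed.

Lemma component_eqP c d : component c = component d <-> legally_related c d.
Proof.
split=> [eqcd | rcd]; first by have := component_mem d; rewrite -eqcd.
apply/seteqP; split=> c' /= ?; last exact: related_trans rcd _.
by apply: related_trans (related_sym rcd) _.
Qed.

Lemma mem_component c C : components C -> C c -> C = component c.
Proof. by move=> [d _ <-] /component_eqP. Qed.

(** * Shifts of components *)

Definition addc n c : config N := (c.1 + zvec n, c.2).

Lemma addcE n c x : (addc n c).1 x = c.1 x + (n x)%:Z.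
Proof. by rewrite !ffunE. Qed.


Lemma addc2 n c : (addc n c).2 = c.2.
Proof. by []. Qed.
Lemma fire_addc n a c : fire a (addc n c) = addc n (fire a c).
Proof.
by apply: config_eq => // x; rewrite fireE !addcE fireE addc2; lia.
Qed.

Lemma firew_addc n w c : firew w (addc n c) = addc n (firew w c).
Proof. by elim: w c => //= a w IHw c; rewrite fire_addc IHw. Qed.

Lemma legal_addc n w c : legal w c -> legal w (addc n c).
Proof.
elim: w c => //= a w IHw c [la lw]; split; last by rewrite fire_addc; exact: IHw.
by move: la; rewrite /legal_letter addcE; lia.
Qed.

Lemma leads_addc n c d : leads c d -> leads (addc n c) (addc n d).
Proof.
by move=> [w [lw <-]]; exists w; rewrite firew_addc; split=> //; exact: legal_addc.
Qed.

Lemma related_addc n c d :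
  legally_related c d -> legally_related (addc n c) (addc n d).
Proof. by move=> [c' ? ?]; exists (addc n c'); exact: leads_addc. Qed.

Lemma addcD n n' c : addc (n + n') c = addc n (addc n' c).
Proof. by rewrite /addc /= zvecD addrA addrAC. Qed.

Lemma addc0 c : addc 0 c = c.
Proof. by case: c => x q; rewrite /addc zvec0 addr0. Qed.

(** Adding letters preserves legality, so related configurations have related translates and the
    union in [shift] is a single component. *)
Lemma shift_component n c : shift n (component c) = component (addc n c).
Proof.
apply/seteqP; split=> [d [c' rcc'] | d rd]; last first.
  by exists c => //; exact: component_mem.
by apply: related_trans; exact: related_addc.
Qed.

Lemma shiftD n n' C :
  components C -> shift (n + n') C = shift n (shift n' C).
Proof. by move=> [c _ <-]; rewrite !shift_component addcD. Qed.

Lemma shift0 C : components C -> shift 0 C = C.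
Proof. by move=> [c _ <-]; rewrite shift_component addc0. Qed.

Lemma shift_comm n n' C :
  components C -> shift n (shift n' C) = shift n' (shift n C).
Proof. by move=> ?; rewrite -!shiftD // addrC. Qed.

Lemma shift_fixed_muln n C k :
  components C -> shift n C = C -> shift (n *+ k) C = C.
Proof.
move=> cC nC; elim: k => [|k IHk]; first by rewrite mulr0n shift0.
by rewrite mulrS shiftD // IHk.
Qed.

(** * Stable configurations *)

Lemma stable_legal w c : stable c -> legal w c -> w = [::].
Proof.
case: w => //= a w /(_ a) le0 [la _]; move: la; rewrite /legal_letter.
by move=> /le_trans/(_ le0); rewrite ler10.
Qed.

Lemma related_stable c d : stable d -> legally_related c d -> leads c d.
Proof.
move=> sd [d' cd' [w [lw eqd]]]; move: cd'; rewrite -eqd.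
by rewrite (stable_legal sd lw).
Qed.

Lemma stable_unique c d : stable c -> stable d -> legally_related c d -> c = d.
Proof.
by move=> sc sd /(related_stable sd) [w [/(stable_legal sc) -> <-]].
Qed.

Lemma legal_nonneg w c a : legal w c -> 0 <= c.1 a -> 0 <= (firew w c).1 a.
Proof.
elim: w c => //= b w IHw c [lb lw] c0; apply: IHw => //.
move: lb; rewrite /legal_letter fireE.
move: (messages b c.2 a) c0 => m; case: eqVneq => [-> | _].
  by move: (c.1 a) => i; lia.
by move: (c.1 a) (c.1 b) => i j; lia.
Qed.

Lemma legal_mem_nonneg w c a : legal w c -> a \in w -> 0 <= (firew w c).1 a.
Proof.
elim: w c => // b w IHw c [lb lw]; rewrite inE => /predU1P[-> | aw].
  apply: (legal_nonneg lw); move: lb; rewrite /legal_letter fireE eqxx.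
  move: (c.1 b) => i; lia.
exact: IHw.
Qed.

Lemma mem_consumed w c a :
  1 <= c.1 a -> (firew w c).1 a <= 0 -> a \in w.
Proof.
move=> ca wa; apply/negPn/negP => /count_memPn naw.
by move: ca wa; rewrite firewE naw; lia.
Qed.

End NetworkDynamics.

(** * Stabilization *)

Section Subcritical.
Local Open Scope ring_scope.
Variables (G : digraph) (N : finite_abelian_network G).
Local Notation natvec := {ffun letter N -> nat}.
Implicit Types (a b : letter N) (w u : seq (letter N)) (q : states N).
Implicit Types (n : natvec) (c d : config N) (C : set (config N)).

Lemma count_word_of n a : count_mem a (word_of n) = n a.
Proof.
rewrite /word_of count_flatten -map_comp.
rewrite (@eq_map _ _ _ (fun b => n b * (b == a))%N); last first.
  by move=> b /=; rewrite count_nseq mulnC.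
rewrite sumnE big_map big_enum /= (bigD1 a) //= eqxx muln1 big1 ?addn0 //.
by move=> b /negPf ->; rewrite muln0.
Qed.

Lemma firew_word_of n c x :
  (firew (word_of n) c).1 x = c.1 x + (messagesn n c.2 x)%:Z - (n x)%:Z.
Proof. by rewrite firewE count_word_of. Qed.

Lemma local_monoid_comm : comm_map_monoid (@local_monoid G N).
Proof.
split; first by exists [::].
  move=> _ _ [w _ <-] [u _ <-]; exists (u ++ w) => //.
  by apply: funext => q; exact: actw_cat.
by move=> _ _ [w _ <-] [u _ <-]; apply: funext => q; exact: actw_comm.
Qed.

Lemma local_monoid_finite : finite_set (@local_monoid G N).
Proof.
apply: (@sub_finite_set _ _
  (range (fun h : {ffun states N -> states N} => h : _ -> _))).
  by move=> f _; exists (finfun f) => //; apply: funext => q; rewrite ffunE.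
by apply: finite_image; exact: finite_finset.
Qed.

(** The minimal idempotent of the local monoid is itself the action of a word. *)
Lemma loc_reachable : exists w, forall q, loc (actw w q).
Proof.
have [w _ defe] := minimal_idempotent_in local_monoid_comm local_monoid_finite.
by exists w => q; exists q => //; rewrite defe.
Qed.

Lemma loc_iter_act a :
  exists2 k, (0 < k)%N & forall q, loc q -> iter k (act a) q = q.
Proof.
have Ma : @local_monoid G N (act a) by exists [:: a].
have [k k0 ek] :=
  minimal_idempotent_absorb_iter local_monoid_comm local_monoid_finite Ma.
exists k => // _ [q _ <-]; rewrite -[RHS](congr1 (fun h => h q) ek) /=.
have Mk := map_monoid_iter local_monoid_comm k Ma.
have Me := minimal_idempotent_in local_monoid_comm local_monoid_finite.
have [_ _ comm] := local_monoid_comm.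
exact: (congr1 (fun h => h q) (comm _ _ Mk Me)).
Qed.

Lemma loc_period : exists2 m, (0 < m)%N &
  forall n q, (forall a, (m %| n a)%N) -> loc q -> actn n q = q.
Proof.
have /choice[k kP] : forall a, exists k,
    (0 < k)%N /\ forall q, loc q -> iter k (act a) q = q.
  by move=> a; have [k] := loc_iter_act a; exists k.
exists (\prod_a k a)%N.
  by rewrite prodn_gt0 // => a; have [] := kP a.
move=> n q mn locq; rewrite /actn /word_of.
elim: (enum _) => //= a s IHs; rewrite actw_cat.
suff -> : actw (nseq (n a) a) q = q by [].
have -> : actw (nseq (n a) a) q = iter (n a) (act a) q.
  by elim: (n a) => //= i <-; rewrite -actw_fire.
have /dvdnP[l ->] : (k a %| n a)%N.
  by apply: dvdn_trans (mn a); rewrite (bigD1 a) //= dvdn_mulr.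
by rewrite iterM iter_fix //; apply: (kP a).2.
Qed.

Lemma nonneg_kernel n :
  (forall q, loc q -> actn n q = q) -> total_kernel (zvec n).
Proof.
move=> nq q locq; have -> : pos_part (zvec n) = n.
  by apply/ffunP => a; rewrite !ffunE; lia.
have -> : neg_part (zvec n) = 0.
  by apply/ffunP => a; rewrite !ffunE; lia.
rewrite nq // /actn (_ : word_of 0 = [::]) //.
by rewrite /word_of; elim: (enum _) => //= a s ->; rewrite ffunE.
Qed.

(* The vector k = (I - P)^-1 y is read off a subinvariant vector of the
   production matrix P. *)
Lemma neutral_firing q0 : subcritical N -> loc q0 ->
  exists k y : natvec, (forall a, (0 < y a)%N) /\
    forall q, loc q -> actn k q = q /\ messagesn k q + y = k.
Proof.
move=> [P prodP subP] loc0; have [m m0 mP] := loc_period.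
have ker n : (forall a, (m %| n a)%N) -> total_kernel (zvec n).
  by move=> mn; apply: nonneg_kernel => q; exact: mP.
have P0 i j : 0 <= P i j.
  (* Column [j] of [P] is tested on [m] copies of the letter [j], a vector of the total kernel: its
     image counts messages. *)
  pose n : natvec := [ffun a => m * (a == enum_val j)]%N.
  have mn a : (m %| n a)%N by rewrite ffunE dvdn_mulr.
  have := prodP n q0 (ker n mn) loc0.
  have -> : colvec n = m%:R *: delta_mx j 0.
    apply/colP => l; rewrite !mxE ffunE (inj_eq enum_val_inj) natrM.
    by rewrite eqxx andbT.
  rewrite -scalemxAr -colE => /matrixP => /(_ i 0); rewrite !mxE => eqP.
  by rewrite -(@pmulr_rge0 _ m%:R) ?ltr0n ?eqP.
have [k' ltk] := subinvariant_vector m0 P0 subP.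
pose k : natvec := [ffun a => m * k' (enum_rank a)]%N.
have mk a : (m %| k a)%N by rewrite ffunE dvdn_mulr.
have colk : colvec k = \col_j (m * k' j)%:R.
  by apply/colP => j; rewrite !mxE ffunE enum_valK.
have prodk q : loc q -> P *m colvec k = colvec (messagesn k q).
  by move=> locq; apply: prodP => //; exact: ker.
have lt_mk a : (messagesn k q0 a < k a)%N.
  have := ltk (enum_rank a); rewrite -colk (prodk _ loc0) !mxE enum_rankK.
  by rewrite ltr_nat [k a]ffunE.
exists k, [ffun a => k a - messagesn k q0 a]%N; split=> [a | q locq].
  by rewrite ffunE subn_gt0.
split; first exact: mP.
(* Both sides are given by [P k], so [y], computed at [q0], serves every locally recurrent state. *)
have eqm : messagesn k q = messagesn k q0.
  apply/ffunP => a; apply/eqP; rewrite -(@eqr_nat rat); apply/eqP.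
  have /matrixP := etrans (esym (prodk _ locq)) (prodk _ loc0).
  move=> /(_ (enum_rank a) 0).
  by rewrite !mxE enum_rankK.
apply/ffunP => a; rewrite ffunE eqm ffunE; apply: subnKC; exact: ltnW.
Qed.

Hypothesis subN : subcritical N.

Lemma legal_size_bounded c : exists B, forall w, legal w c -> (size w <= B)%N.
Proof.
have [w0 loc0] := loc_reachable.
have [k [y [y0 kP]]] := neutral_firing subN (loc0 c.2).
(* The prefix [w0] reaches a locally recurrent state; each later copy of [k] then subtracts [y]. *)
pose u j := w0 ++ flatten (nseq j (word_of k)).
have uP j : (firew (u j) c).2 = actw w0 c.2 /\
    forall x, (firew (u j) c).1 x = (firew w0 c).1 x - (j * y x)%N%:Z.
  rewrite /u firew_cat; elim: j => [|j [IH2 IH1]] /=.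
    by split=> [|x]; rewrite ?firew2 // mul0n subr0.
  rewrite (firew_perm _ (_ : perm_eq _ (flatten (nseq j (word_of k)) ++ word_of k)));
    last by rewrite perm_catC.
  rewrite firew_cat; have [] := kP _ (loc0 c.2); rewrite -{1 2}IH2.
  move=> act_k msg_k; split=> [|x].
    by rewrite firew2 -IH2; exact: act_k.
  rewrite firew_word_of IH1.
  have := congr1 (fun n : natvec => n x) msg_k; rewrite natvecDE IH2 mulSn.
  move=> <-; move: (messagesn k _ x) ((firew w0 c).1 x) (y x) => i z t; lia.
have [j jP] : exists j, stable (firew (u j) c).
  (* As [y >= 1], this many copies of [k] push every entry down to 0 or below. *)
  exists (\sum_x `|(firew w0 c).1 x|)%N => x; rewrite (uP _).2.
  set s := (\sum_x _)%N.
  have : (`|(firew w0 c).1 x| <= s)%N by rewrite /s (bigD1 x) //= leq_addr.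
  have : (s <= s * y x)%N by rewrite leq_pmulr.
  by move: s ((firew w0 c).1 x) => s i; lia.
(* The residual of [w] after [u j] is legal for a stable configuration, hence empty: [w] is a
   sub-multiset of [u j]. *)
exists (size (u j)) => w lw.
have := perm_size (wdiff_perm w (u j)).
rewrite (stable_legal jP (legal_wdiff (u j) lw)) cats0 size_cat => <-.
exact: leq_addr.
Qed.

Lemma stabilization c : exists2 d, stable d & leads c d.
Proof.
have [B leB] := legal_size_bounded c.
suff stab m w : legal w c -> (B - size w <= m)%N -> exists2 d, stable d & leads c d.
  by apply: (stab B [::] I); rewrite subn0.
have fires u : legal u c -> ~ stable (firew u c) ->
    exists2 a, legal (rcons u a) c & (size u < B)%N.
  move=> lu nst; have [a la] : exists a, legal_letter a (firew u c).
    apply: contrapT => nla; apply: nst => a; rewrite leNgt; apply/negP => a0.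
    by apply: nla; exists a; rewrite /legal_letter; lia.
  have lua : legal (rcons u a) c by rewrite -cats1; apply/legal_cat.
  by exists a => //; have := leB _ lua; rewrite size_rcons.
elim: m w => [|m IHm] w lw ltm.
all: have [st | /(fires _ lw)[a lwa ltB]] := pselect (stable (firew w c)).
all: try by exists (firew w c) => //; exists w.
  by move: ltm; rewrite leqn0 subn_eq0 leqNgt ltB.
by apply: (IHm _ lwa); rewrite size_rcons; lia.
Qed.

Definition gstate q : set (config N) := component (0, q).

Lemma stable_zero q : stable (0, q).
Proof. by move=> a; rewrite ffunE. Qed.

Lemma gstatesP C : gstates N C <-> exists q, C = gstate q.
Proof.
split=> [[cC [q eqC]] | [q ->]].
  exists q; apply: mem_component => //.
  by have [] : (C `&` @stable G N) (0, q) by rewrite eqC.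
split; first by exists (0, q).
exists q; apply/seteqP; split=> [c [rc sc] | c /= ->].
  by apply/esym/stable_unique => //; exact: stable_zero.
by split; [exact: component_mem | exact: stable_zero].
Qed.

Lemma gstates_component C : gstates N C -> components C.
Proof. by case. Qed.

(** Legal firing keeps nonnegative entries nonnegative, so the stabilization has all entries equal
    to 0. *)
Lemma nonneg_gstates c : (forall a, 0 <= c.1 a) -> gstates N (component c).
Proof.
move=> c0; have [[x q] sd [w [lw eqd]]] := stabilization c.
have x0 : x = 0.
  apply/ffunP => a; rewrite ffunE; apply/eqP; rewrite eq_le (sd a) /=.
  by have := legal_nonneg lw (c0 a); rewrite eqd.
apply/gstatesP; exists q; apply/component_eqP/leads_related.
by exists w; split=> //; rewrite eqd x0.
Qed.

Lemma shift_gstates n C : gstates N C -> gstates N (shift n C).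
Proof.
move=> /gstatesP[q ->]; rewrite shift_component; apply: nonneg_gstates => a.
by rewrite addcE ffunE.
Qed.

End Subcritical.

(** * Shifts and walks *)

Lemma patch_at (T : Type) (Y : set T) (f : T -> T) x :
  Y x -> patch id Y f x = f x.
Proof. by move=> Yx; rewrite /patch mem_set. Qed.

Lemma patch_away (T : Type) (Y : set T) (f : T -> T) x :
  ~ Y x -> patch id Y f x = x.
Proof. by move=> nYx; rewrite /patch memNset. Qed.

Section RestrictedShift.
Local Open Scope ring_scope.
Variables (G : digraph) (N : finite_abelian_network G).
Local Notation natvec := {ffun letter N -> nat}.
Variable Y : set (set (config N)).
Hypothesis Y_components : Y `<=` @components G N.
Hypothesis Y_shift : forall n C, Y C -> Y (shift n C).
Local Notation act_Y := (fun n : natvec => patch id Y (shift n)).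

Lemma restr_shift0 : patch id Y (shift 0) = id.
Proof.
apply: funext => C; have [YC | nYC] := pselect (Y C).
  by rewrite patch_at // shift0 //; exact: Y_components.
by rewrite patch_away.
Qed.

Lemma restr_shiftD n n' :
  patch id Y (shift (n + n')) = patch id Y (shift n) \o patch id Y (shift n').
Proof.
apply: funext => C /=; have [YC | nYC] := pselect (Y C).
  rewrite !patch_at // ?shiftD //; first exact: Y_components.
  exact: Y_shift.
by rewrite !patch_away.
Qed.

(** Taken with [Y] equal to [gstates N] for the global monoid and to [rec_components N] for the
    shift monoid. *)
Lemma restr_shift_monoid : comm_map_monoid (range act_Y).
Proof.
split; first by exists 0 => //; exact: restr_shift0.
  by move=> _ _ [n _ <-] [n' _ <-]; exists (n + n') => //; exact: restr_shiftD.
by move=> _ _ [n _ <-] [n' _ <-]; rewrite -!restr_shiftD addrC.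
Qed.

Lemma restr_shift_muln n k :
  patch id Y (shift (n *+ k)) = iter k (patch id Y (shift n)).
Proof.
elim: k => [|k IHk]; first by rewrite mulr0n restr_shift0.
by rewrite mulrS restr_shiftD IHk.
Qed.

End RestrictedShift.

(** * Infinite walks *)

Section Walks.
Local Open Scope ring_scope.
Variables (G : digraph) (N : finite_abelian_network G).
Local Notation natvec := {ffun letter N -> nat}.
Implicit Types (I : set int) (x : int -> config N) (l : int -> letter N).

Lemma walk_forward I x l K : (forall i, 0 <= i -> I i) -> walk I x l ->
  legal (mkseq (fun i => l i.+1%:Z) K) (x 0).
Proof.
move=> Ige0 wx.
suff [] : legal (mkseq (fun i => l i.+1%:Z) K) (x 0) /\
  firew (mkseq (fun i => l i.+1%:Z) K) (x 0) = x K%:Z by [].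
elim: K => [|K [lK eqK]] //; rewrite mkseqS -cats1.
have Kp : K.+1%:Z - 1 = K%:Z by lia.
have [] := wx K.+1%:Z (Ige0 _ _) (Ige0 _ _); rewrite ?Kp // => la fa.
rewrite firew_cat eqK; split=> //; apply/legal_cat; split=> //=.
by rewrite eqK.
Qed.

(** The last [m] labels of a walk that ends at index 0, in walking order; the word leads from
    [x (- m)] to [x 0]. *)
Definition backward_word l m := rev (mkseq (fun i => l (- i%:Z)) m).

Lemma backward_wordS l m :
  backward_word l m.+1 = l (- m%:Z) :: backward_word l m.
Proof. by rewrite /backward_word mkseqS rev_rcons. Qed.

Lemma walk_backward I x l m : (forall i, i <= 0 -> I i) -> walk I x l ->
  legal (backward_word l m) (x (- m%:Z)) /\
  firew (backward_word l m) (x (- m%:Z)) = x 0.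
Proof.
move=> Ile0 wx; elim: m => [|m [lm eqm]] //; rewrite backward_wordS /=.
have eqi : - m%:Z - 1 = - m.+1%:Z by lia.
have [] := wx (- m%:Z) (Ile0 _ _) (Ile0 _ _); rewrite ?eqi; [lia | lia |].
by move=> la ->.
Qed.

Lemma count_backward_mono l a m m' : (m <= m')%N ->
  (count_mem a (backward_word l m) <= count_mem a (backward_word l m'))%N.
Proof.
elim: m' => [|m' IHm']; first by rewrite leqn0 => /eqP ->.
rewrite leq_eqVlt => /predU1P[-> // | /IHm' le_m].
by apply: leq_trans le_m _; rewrite backward_wordS leq_addl.
Qed.

Lemma diverse_backward l (W : natvec) : diverse [set i : int | i <= 0] l ->
  exists m, forall a, (W a <= count_mem a (backward_word l m))%N.
Proof.
move=> div_l.
(* Otherwise [a] labels only indices between [- m] and 0, which are finitely many. *)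
have late a m : exists2 m', (m <= m')%N & l (- m'%:Z) = a.
  apply: contrapT => none; apply: (div_l a).
  apply: (@sub_finite_set _ _ (range (fun j : 'I_m => - (j : nat)%:Z))).
    move=> i [_ /= le_i0 eqa]; have [lt_im | le_mi] := ltnP `|i|%N m.
      by exists (Ordinal lt_im) => //=; lia.
    exfalso; apply: none; exists `|i|%N => //; rewrite -eqa; congr l; lia.
  by apply: finite_image; exact: finite_finset.
have many a : exists m, (W a <= count_mem a (backward_word l m))%N.
  elim: (W a) => [|w [m le_w]]; first by exists 0%N.
  have [m' le_m eqa] := late a m; exists m'.+1.
  rewrite backward_wordS /= eqa eqxx ltnS.
  exact: leq_trans le_w (count_backward_mono _ _ le_m).
have /choice[f fP] := many.
exists (\sum_a f a)%N => a; apply: leq_trans (fP a) _.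
by apply: count_backward_mono; rewrite (bigD1 a) //= leq_addr.
Qed.

(* The walk goes through the configurations x + j n (j = 0, 1, ...), from each
   to the previous one along w. *)
Lemma periodic_walk (C : set (config N)) c (n : natvec) w :
  components C -> C c -> (forall a, a \in w) -> legal w (addc n c) ->
  firew w (addc n c) = c -> rec_components N C.
Proof.
move=> cC Cc w_all lw eqw; split=> //.
have rel_base j : legal w (addc (n *+ j.+1) c) /\
    firew w (addc (n *+ j.+1) c) = addc (n *+ j) c.
  rewrite mulrSr addcD firew_addc eqw; split=> //; exact: legal_addc.
(* Some letter exists: it serves as the default value of [nth] and shows that [w] is nonempty. *)
have /card_gt0P[v _] := vertex_gt0 G.
have /card_gt0P[a _] := alph_gt0 N v.
pose a0 : letter N := Tagged (fun v => alph N v) a.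
have wgt0 : (0 < size w)%N by case: (w) (w_all a0).
set L := size w in wgt0.
(* [X m] lies [m] steps before [c]: with [r = m %% L], all but the last [r] letters of [w] are fired
   from the current translate of [c]. The letter [l m] leads from [X m.+1] to [X m]. *)
pose X m := firew (take (L - m %% L) w) (addc (n *+ (m %/ L).+1) c).
pose l m := nth a0 w (L - (m %% L).+1).
have XS m : X m.+1
    = firew (take (L - (m %% L).+1) w) (addc (n *+ (m %/ L).+1) c).
  rewrite /X {1 2}(divn_eq m L) -addnS.
  (* At the end of a period the base moves to the next multiple of [n], from which all of [w] leads
     to the present base. *)
  have := ltn_pmod m wgt0; rewrite leq_eqVlt => /predU1P[-> | ltr].
    rewrite subnn take0 -mulSnr mulnK // modnMl subn0 take_size.
    by rewrite (rel_base _).2.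
  by rewrite divnMDl // modnMDl (divn_small ltr) addn0 (modn_small ltr).
have step m : legal_letter (l m) (X m.+1) /\ fire (l m) (X m.+1) = X m.
  have lt_s : (L - (m %% L).+1 < L)%N by rewrite ltn_subrL.
  have eqs : (L - m %% L = (L - (m %% L).+1).+1)%N.
    by have := ltn_pmod m wgt0; lia.
  rewrite XS; split; last by rewrite /X eqs (take_nth a0) // firew_rcons.
  have [lw' _] := rel_base (m %/ L)%N.
  rewrite -(cat_take_drop (L - (m %% L).+1) w) (drop_nth a0) // in lw'.
  by have [_ []] := (legal_cat _ _ _).1 lw'.
have Xcomp m : C (X m).
  elim: m => [|m IHm].
    by rewrite /X mod0n div0n subn0 take_size (rel_base _).2 mulr0n addc0.
  rewrite (mem_component cC IHm); apply/related_sym/leads_related.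
  by exists [:: l m]; have [? ?] := step m.
exists [set i : int | i <= 0], (fun i => X `|i|%N), (fun i => l `|i|%N).
split=> //; first by constructor 1.
  move=> i _ /= le_i0; have -> : `|i - 1|%N = `|i|%N.+1 by lia.
  exact: step.
move=> b; have /(nthP a0)[s lts eqb] := w_all b.
have fin_nat := @infinite_nat; apply: contra_not fin_nat => fin.
(* The index at which position [s] of [w] is read in the [d]-th copy of [w], counted backwards from
   0. *)
pose g (d : nat) : int := - (d * L + (L - s.+1))%N%:Z.
have g_inj : {in [set: nat] &, injective g}.
  move=> d d' _ _ /eqP; rewrite /g eqr_opp eqz_nat eqn_add2r eqn_pmul2r //.
  by move/eqP.
rewrite -(eq_finite_set (inj_card_eq g_inj)); apply: sub_finite_set fin.
move=> _ [d _ <-]; rewrite /g; split=> /=; [lia | lia |].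
have lt_s : (L - s.+1 < L)%N by rewrite ltn_subrL.
rewrite /l abszN absz_nat modnMDl modn_small // -eqb; congr nth.
by move: lts; rewrite -/L; lia.
Qed.

End Walks.

(** * Recurrent components and the critical group *)

Section CriticalGroup.
Local Open Scope ring_scope.
Variables (G : digraph) (N : finite_abelian_network G).
Local Notation natvec := {ffun letter N -> nat}.
Implicit Types (n : natvec) (C : set (config N)).
Hypothesis subN : subcritical N.

(** A walk unbounded to the right would give legal words of every length from [x 0]; a recurrent
    component therefore gets its walk from the past. *)
Lemma rec_components_backward C : rec_components N C -> exists x l,
  [/\ walk [set i | i <= 0] x l, diverse [set i | i <= 0] l & C (x 0)].
Proof.
move=> [cC [I [x [l [Idx wx div_l CI]]]]].
have no_forward : ~ forall i, 0 <= i -> I i.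
  move=> Ige0; have [B leB] := legal_size_bounded subN (x 0).
  by have := leB _ (walk_forward B.+1 Ige0 wx); rewrite size_mkseq ltnn.
case: Idx => eqI; first by subst I; exists x, l; split=> //; exact: CI.
- by exfalso; apply: no_forward; rewrite eqI.
- by exfalso; apply: no_forward; rewrite eqI.
Qed.

(* A legal word w from c containing w0 and k stays legal after both are
   fired; as firing k turns c + y into c, the words w from c + y and w minus k
   from c end at the same place. *)
Lemma rec_components_fixed C : rec_components N C ->
  gstates N C /\ exists2 n : natvec, (forall a, (0 < n a)%N) & shift n C = C.
Proof.
move=> recC; have cC := recC.1.
have [x [l [wx div_l Cx0]]] := rec_components_backward recC.
have [w0 loc0] := loc_reachable N.
have [k [y [y0 kP]]] := neutral_firing subN (loc0 (x 0).2).
(* The word must contain [w0] and [k] together; the successor makes every letter occur in it, even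
   where both counts vanish. *)
have [m leW] := diverse_backward [ffun a => (count_mem a w0 + k a).+1] div_l.
have [lw eqw] := walk_backward m (fun i (i0 : i <= 0) => i0) wx.
set w := backward_word l m in leW lw eqw; set c := x _ in lw eqw.
have w_all a : a \in w.
  by rewrite -has_pred1 has_count (leq_trans _ (leW a)) // ffunE.
split.
  rewrite (mem_component cC Cx0) -eqw; apply: nonneg_gstates => // a.
  exact: legal_mem_nonneg.
exists y => //.
(* Firing [w0] first makes the state locally recurrent; [v] leads from [d] to the end of [w], so [d]
   stays in [C]. *)
pose v := wdiff w w0; pose d := firew w0 c.
have lv : legal v d by exact: legal_wdiff.
have loc_d : loc d.2 by rewrite /d firew2.
have wdiff_nil u u' : (forall a, (count_mem a u <= count_mem a u')%N) ->
    wdiff u u' = [::].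
  move=> le_u; case eqs: (wdiff u u') => [//|a s].
  by have := count_wdiff u u' a; rewrite eqs /= eqxx (eqP (le_u a)).
have eqv : firew v d = firew w c.
  rewrite /v /d -firew_wdiff wdiff_nil // => a.
  by rewrite (leq_trans _ (leW a)) // ffunE -addnS leq_addr.
have -> : C = component d.
  rewrite (mem_component cC Cx0) -eqw -eqv.
  by apply/component_eqP/related_sym/leads_related; exists v.
have [act_k msg_k] := kP _ loc_d.
have eqd : firew (word_of k) (addc y d) = d.
  apply: config_eq => [b|]; last by rewrite firew2 addc2; exact: act_k.
  rewrite firew_word_of addcE addc2.
  have := congr1 (fun n : natvec => n b) msg_k; rewrite natvecDE => <-.
  by move: (messagesn k _ b) (d.1 b) (y b) => i z t; lia.
rewrite shift_component; apply/component_eqP.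
(* The common target of [d + y] and [d]: the latter is what [k] makes of [d + y], and the residual
   of [v] after [k] completes it. *)
exists (firew v (addc y d)); first by exists v; split=> //; exact: legal_addc.
exists (wdiff v (word_of k)); split.
  by rewrite -[X in legal _ X]eqd; exact/legal_wdiff/legal_addc.
rewrite -[X in firew _ X = _]eqd -firew_wdiff wdiff_nil // => a.
rewrite count_word_of /v count_wdiff.
by have := leW a; rewrite ffunE; move: (count_mem a w); lia.
Qed.

(** With [C] the component of the stable [0.q], some legal [w] leads from [n.q] to [0.q]. It
    consumes every letter, hence contains every letter, and yields a periodic walk. *)
Lemma fixed_rec_components n C : gstates N C -> (forall a, (0 < n a)%N) ->
  shift n C = C -> rec_components N C.
Proof.
move=> gC n0; have [q defC] := (gstatesP _).1 gC.
rewrite {1}defC shift_component defC => /component_eqP.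
move=> /(related_stable (@stable_zero _ _ q)) [w [lw eqw]].
apply: (periodic_walk (c := (0, q)) (n := n) (w := w)) => //.
- by rewrite -defC; exact: gstates_component gC.
- exact: component_mem.
- move=> a; apply: (@mem_consumed _ _ w (addc n (0, q))); last by rewrite eqw ffunE.
  by rewrite addcE ffunE add0r; have := n0 a; lia.
Qed.

Lemma rec_components_gstates C : rec_components N C -> gstates N C.
Proof. by move=> /rec_components_fixed[]. Qed.

Lemma shift_rec_components n C : rec_components N C -> rec_components N (shift n C).
Proof.
move=> recC; have [gC [y y0 yC]] := rec_components_fixed recC.
apply: (@fixed_rec_components y) => //; first exact: shift_gstates.
by rewrite shift_comm ?yC //; exact: gstates_component.
Qed.

(** * The global monoid and its minimal idempotent *)

Local Notation M := (global_monoid N).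
Local Notation e := (minimal_idempotent M).

Lemma global_monoid_comm : comm_map_monoid M.
Proof.
exact: (restr_shift_monoid (@gstates_component _ _) (shift_gstates subN)).
Qed.

(** An element is determined by a self-map of the finite set of states, being the identity outside
    [gstates N]. *)
Lemma global_monoid_finite : finite_set M.
Proof.
pose ext (h : {ffun states N -> states N}) C :=
  if [pick q | `[< C = gstate q >]] is Some q then gstate (h q) else C.
apply: (@sub_finite_set _ _ (range ext)); last first.
  by apply: finite_image; exact: finite_finset.
move=> _ [n _ <-].
have /choice[h hP] : forall q : states N, exists q', shift n (gstate q) = gstate q'.
  by move=> q; apply/gstatesP/(shift_gstates subN)/gstatesP; exists q.
exists (finfun h) => //; apply: funext => C; rewrite /ext.
case: pickP => [q /asboolP -> | noq]; rewrite /global_act.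
  by rewrite ffunE patch_at ?hP //; apply/gstatesP; exists q.
rewrite patch_away // => /gstatesP[q defC].
by have /asboolP := noq q.
Qed.

Lemma global_idempotent_in : M e.
Proof.
exact: (minimal_idempotent_in global_monoid_comm global_monoid_finite).
Qed.

Lemma global_idempotent_idem : e \o e = e.
Proof.
exact: (minimal_idempotent_idem global_monoid_comm global_monoid_finite).
Qed.

Lemma global_idempotent_iter m : M m -> exists2 k, (0 < k)%N &
  forall C, e C = C -> iter k m C = C.
Proof.
move=> Mm; have [k k0 ek] :=
  minimal_idempotent_absorb_iter global_monoid_comm global_monoid_finite Mm.
exists k => // D eD; have Mk := map_monoid_iter global_monoid_comm k Mm.
have [_ _ comm] := global_monoid_comm.
rewrite -{1}eD -[RHS]eD -[RHS](congr1 (fun f => f D) ek).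
exact: (congr1 (fun f => f D) (comm _ _ Mk global_idempotent_in)).
Qed.

Lemma global_act_at n C : gstates N C -> global_act n C = shift n C.
Proof. exact: patch_at. Qed.

Lemma global_monoid_away m C : M m -> ~ gstates N C -> m C = C.
Proof. by move=> [n _ <-]; exact: patch_away. Qed.

Lemma global_monoid_gstates m C : M m -> gstates N C -> gstates N (m C).
Proof. by move=> [n _ <-] gC; rewrite global_act_at //; exact: shift_gstates. Qed.

Lemma global_act_muln n k : global_act (n *+ k) = iter k (global_act n).
Proof.
exact: (restr_shift_muln (@gstates_component _ _) (shift_gstates subN)).
Qed.

Lemma global_actD n n' : global_act (n + n') = global_act n \o global_act n'.
Proof. exact: (restr_shiftD (@gstates_component _ _) (shift_gstates subN)). Qed.

(** If [e] is the shift by [n], a multiple of [y] that dominates [n] factors through [e] and fixes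
    [C], so [C] lies in the image of [e]. *)
Lemma rec_idempotent_fixed C : rec_components N C -> e C = C.
Proof.
move=> recC; have [gC [y y0 yC]] := rec_components_fixed recC.
have [n _ defe] := global_idempotent_in.
have ee := global_idempotent_idem.
pose k := (\sum_a n a)%N.
have defyk : y *+ k = n + [ffun a => (y *+ k) a - n a]%N.
  apply/ffunP => a; rewrite natvecDE [X in (_ + X)%N]ffunE subnKC //.
  rewrite natvecMnE (leq_trans (_ : n a <= k)%N) ?leq_pmull //.
  by rewrite /k (bigD1 a) //= leq_addr.
have fixC : global_act (y *+ k) C = C.
  by rewrite global_act_at // shift_fixed_muln //; exact: gstates_component.
by rewrite -fixC defyk global_actD defe /= -[LHS]/((e \o e) _) ee.
Qed.

(** On components fixed by [e] each unit shift has finite order; adding up these multiples over all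
    letters gives a positive vector that fixes [C]. *)
Lemma idempotent_fixed_rec C : gstates N C -> e C = C -> rec_components N C.
Proof.
move=> gC eC; have cC := gstates_component gC.
pose one a : natvec := [ffun b => (b == a) : nat].
have /choice[k kP] : forall a, exists k, (0 < k)%N /\ shift (one a *+ k) C = C.
  move=> a; have Ma : M (global_act (one a)) by exists (one a).
  have [k k0 fixk] := global_idempotent_iter Ma.
  by exists k; split=> //; rewrite -(global_act_at _ gC) global_act_muln fixk.
apply: (@fixed_rec_components (\sum_a one a *+ k a)) => //.
  move=> a; rewrite (bigD1 a) //= natvecDE natvecMnE ffunE eqxx mul1n.
  by rewrite ltn_addr //; have [] := kP a; case: (k a).
elim/big_ind: _ => [|n n' nC n'C|a _]; first exact: shift0.
  by rewrite shiftD // n'C.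
exact: (kP a).2.
Qed.

Lemma idempotent_image : e @` gstates N = rec_components N.
Proof.
have ee := global_idempotent_idem.
apply/seteqP; split=> [_ [C gC <-] | C recC].
  apply: idempotent_fixed_rec; last exact: (congr1 (fun f => f C) ee).
  exact: (global_monoid_gstates global_idempotent_in).
by exists C; [exact: rec_components_gstates | exact: rec_idempotent_fixed].
Qed.

(** * The shift monoid and its torsion group *)

Local Notation SM := (shift_monoid N).

Lemma rec_components_components : rec_components N `<=` @components G N.
Proof. by move=> C []. Qed.

Lemma shift_monoid_comm : comm_map_monoid SM.
Proof.
exact: (restr_shift_monoid rec_components_components shift_rec_components).
Qed.

Lemma shift_rec_at n C : rec_components N C -> shift_rec n C = shift n C.
Proof. exact: patch_at. Qed.

Lemma shift_rec0 : @shift_rec G N 0 = id.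
Proof. exact: (restr_shift0 rec_components_components). Qed.

Lemma shift_monoid_rec m C : SM m -> rec_components N C -> rec_components N (m C).
Proof.
by move=> [n _ <-] recC; rewrite shift_rec_at //; exact: shift_rec_components.
Qed.

(** Recurrent components are fixed by [e], so the exponent found in the global monoid restricts to
    them. *)
Lemma shift_monoid_torsion f : SM f -> exists2 k, (0 < k)%N & iter k f = id.
Proof.
move=> [n _ <-]; have Mn : M (global_act n) by exists n.
have [k k0 fixk] := global_idempotent_iter Mn; exists k => //.
rewrite -(restr_shift_muln rec_components_components shift_rec_components).
apply: funext => C; have [recC | nrecC] := pselect (rec_components N C);
  last by rewrite patch_away.
rewrite patch_at // -global_act_at; last exact: rec_components_gstates.
by rewrite global_act_muln fixk //; exact: rec_idempotent_fixed.
Qed.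

Lemma eta_idempotent_act n : eta N (e \o global_act n) = shift_rec n.
Proof.
apply: funext => C; rewrite /eta /shift_rec.
have [recC | nrecC] := pselect (rec_components N C); last by rewrite !patch_away.
rewrite !patch_at //= global_act_at; last exact: rec_components_gstates.
by rewrite rec_idempotent_fixed //; exact: shift_rec_components.
Qed.

Lemma eta_critical g : critical_group N g -> SM (eta N g).
Proof. by move=> [_ [n _ <-] <-]; rewrite eta_idempotent_act; exists n. Qed.

Lemma eta_at g C : rec_components N C -> eta N g C = g C.
Proof. exact: patch_at. Qed.

(** An element of the critical group equals its composite with [e], so its values on [gstates N] are
    determined on the image of [e], the recurrent components. *)
Lemma eta_inj g h : critical_group N g -> critical_group N h ->
  eta N g = eta N h -> g = h.
Proof.
have ee := global_idempotent_idem.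
have grp := minimal_ideal_is_group global_monoid_comm global_monoid_finite.
have eK f C : critical_group N f -> f C = f (e C).
  case: grp => _ _ _ one _ cf; have [_ fe] := one _ cf.
  exact: (congr1 (fun f => f C) (esym fe)).
have away f C : critical_group N f -> ~ gstates N C -> f C = C.
  move=> [m Mm <-] nC; apply: global_monoid_away nC.
  by have [_ comp _] := global_monoid_comm; exact: comp global_idempotent_in Mm.
move=> cg ch eqgh; apply: funext => C.
have [gC | ngC] := pselect (gstates N C); last by rewrite !away.
have recC : rec_components N (e C) by rewrite -idempotent_image; exists C.
by rewrite (eK g) // (eK h) // -(eta_at _ recC) eqgh eta_at.
Qed.

Lemma eta_comp g h : critical_group N g -> critical_group N h ->
  eta N (g \o h) = eta N g \o eta N h.
Proof.
move=> cg ch; apply: funext => C /=.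
have [recC | nrecC] := pselect (rec_components N C);
  last by rewrite /eta !patch_away.
have := shift_monoid_rec (eta_critical ch) recC; rewrite (eta_at h recC) => rechC.
by rewrite !eta_at.
Qed.

Lemma tor_class_bij : set_bij (critical_group N) (tor N)
  (fun g => groth_class SM (eta N g) id).
Proof.
split.
- move=> g /eta_critical Mg.
  exact: (torsion_class shift_monoid_comm shift_monoid_torsion Mg).
- move=> g h; rewrite !inE => cg ch.
  move=> /(groth_class_inj shift_monoid_comm shift_monoid_torsion
    (eta_critical cg) (eta_critical ch)).
  exact: eta_inj.
- move=> t /(torsionP shift_monoid_comm shift_monoid_torsion)[_ [n _ <-] ->].
  exists (e \o global_act n); last by rewrite eta_idempotent_act.
  by exists (global_act n) => //; exists n.
Qed.

(** If [(shift_rec n, shift_rec n')] represents the class of [f], then [shift_rec n] is [f] composed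
    with [shift_rec n']. *)
Lemma tor_related_class f C : SM f -> rec_components N C ->
  tor_related (groth_class SM f id) C (f C).
Proof.
move=> Mf recC; split; first exact: shift_monoid_rec.
move=> n n' eqfn.
have Mn : SM (shift_rec n) by exists n.
have Mn' : SM (shift_rec n') by exists n'.
have := groth_class_mem shift_monoid_comm shift_monoid_torsion Mn Mn'.
have [Mid _ comm] := shift_monoid_comm.
rewrite -eqfn (groth_classE shift_monoid_comm shift_monoid_torsion Mf Mid).
move=> [_ _ /= eqf].
rewrite -!shift_rec_at //; last exact: shift_monoid_rec.
rewrite -[RHS](congr1 (fun g => g C) (comm _ _ Mf Mn')) /=.
exact: (congr1 (fun g => g C) (esym eqf)).
Qed.

Lemma rec_components_invertible : rec_components N = invertible_components N.
Proof.
apply/seteqP; split=> [C recC | C []//]; split=> // t.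
move=> /(torsionP shift_monoid_comm shift_monoid_torsion)[f Mf ->].
by exists (f C); exact: tor_related_class.
Qed.

Lemma tor_act_class f C : SM f -> rec_components N C ->
  tor_act N (groth_class SM f id) C = f C.
Proof.
move=> Mf recC; rewrite /tor_act.
case: xgetP => [C' _ [recC' relC'] | /(_ (f C)) []]; last first.
  exact: tor_related_class.
case: Mf relC' => n _ <- relC'; rewrite shift_rec_at //.
(* The representative [(shift_rec n, id)] forces the chosen [C'] to be [shift n C], whatever [xget]
   returns. *)
rewrite (relC' n 0) ?shift_rec0 // shift0 //.
exact: (rec_components_components recC').
Qed.

End CriticalGroup.

Theorem theorem4p28 (G : digraph) (S : finite_abelian_network G) :
  locally_irreducible S ->
  subcritical S ->
  let e := minimal_idempotent (global_monoid S) in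
  let F := fun g => groth_class (shift_monoid S) (eta S g) id in
  [/\ is_group_isomorphism
        (critical_group S) (fun f g => f \o g) e
        (tor S) (groth_mul (shift_monoid S)) (groth_one (shift_monoid S)) F,
      e @` gstates S = rec_components S /\
      rec_components S = invertible_components S &
      forall g C, critical_group S g -> (e @` gstates S) C ->
        tor_act S (F g) C = g C].
Proof.
move=> _ subS e F; split.
- split.
  + exact: (minimal_ideal_is_group (global_monoid_comm subS)
      (global_monoid_finite subS)).
  + exact: (torsion_is_group (shift_monoid_comm subS) (shift_monoid_torsion subS)).
  + exact: tor_class_bij.
  + move=> g h cg ch; rewrite /F eta_comp //.
    by rewrite (groth_mul_class (shift_monoid_comm subS)
      (shift_monoid_torsion subS)) //; exact: eta_critical.
- by split; [exact: idempotent_image | exact: rec_components_invertible].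
- move=> g C cg; rewrite idempotent_image // => recC.
  by rewrite tor_act_class ?eta_at //; exact: eta_critical.
Qed.
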